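(* Let $G$ be a group and $\tau$ a non-discrete paratopological group topology on $G$. Then there exists a paratopological group topology on $G$ transversal to $\tau$ if and only if $\tau\nleq \mathcal{PM}_G$, i.e. $\tau$ is not coarser than or equal to $\mathcal{PM}_G$.
   Context: A paratopological group topology on a group $G$ is a topology for which multiplication is jointly continuous (no separation axiom is assumed). Two non-discrete topologies on a set are transversal if their union generates the discrete topology. Topologies are ordered by inclusion. Let $\mathcal{PL}(G)$ be the poset of all paratopological group topologies on $G$ and $\delta_G$ the discrete topology. A maximal paratopological group topology on $G$ is a maximal element of $\mathcal{PL}(G)\setminus\{\delta_G\}$. The submaximal paratopological group topology $\mathcal{PM}_G$ is the infimum, in $\mathcal{PL}(G)$, of all maximal paratopological group topologies on $G$ (the infimum of the empty family being $\delta_G$). *)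

(* Defs.v *)
From HB Require Import structures.
From mathcomp Require Import all_boot all_order.
From mathcomp Require Import boolp classical_sets topology.

Set Implicit Arguments.
Unset Strict Implicit.
Unset Printing Implicit Defensive.

Import Order.TTheory.
Local Open Scope classical_set_scope.

(* A topology is its set of open sets, so that one carrier can bear many
   topologies.  The empty set is the union of the empty family. *)
Definition is_topology (T : Type) (O : set (set T)) : Prop :=
  [/\ O setT,
      forall A B, O A -> O B -> O (A `&` B) &
      forall F : set (set T), F `<=` O -> O (\bigcup_(A in F) A)].

Record topology (T : Type) := Topology {
  opens : set (set T);
  opensP : `[< is_topology opens >] }.

(* The order on topologies is inclusion of the sets of open sets: s <= t means
   that s is coarser than t. *)
HB.instance Definition _ (T : Type) := [isSub for @opens T].
HB.instance Definition _ (T : Type) := [Choice of topology T by <:].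
HB.instance Definition _ (T : Type) :=
  [SubChoice_isSubPOrder of topology T by <: with set_display].

Lemma topology_leE (T : Type) (s t : topology T) :
  (s <= t)%O <-> opens s `<=` opens t.
Proof. by rewrite leEsub subsetEset. Qed.

(* T seen as a library topological space whose open sets are opens t. *)
Definition topologized (T : choiceType) (t : topology T) : Type := T.

Section Topologized.
Context (T : choiceType) (t : topology T).

Fact topologized_opT : opens t setT.
Proof. by have /asboolP[] := opensP t. Qed.

Fact topologized_opI (A B : set T) :
  opens t A -> opens t B -> opens t (A `&` B).
Proof. by have /asboolP[_ + _] := opensP t; apply. Qed.

Fact topologized_op_bigU (I : Type) (f : I -> set T) :
  (forall i, opens t (f i)) -> opens t (\bigcup_i f i).
Proof.
move=> tf; have /asboolP[_ _ /(_ (range f))] := opensP t.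
by rewrite bigcup_image; apply=> _ [i _ <-].
Qed.

HB.instance Definition _ := Choice.copy (topologized t) T.
HB.instance Definition _ := isOpenTopological.Build (topologized t)
  topologized_opT topologized_opI topologized_op_bigU.

End Topologized.

Lemma topologized_openE (T : choiceType) (t : topology T)
  (A : set (topologized t)) : open A <-> opens t A.
Proof. by []. Qed.

Lemma topologized_nbhsE (T : choiceType) (t : topology T)
  (x : topologized t) (A : set (topologized t)) :
  nbhs x A <-> exists U : set T, [/\ opens t U, U x & U `<=` A].
Proof. by []. Qed.

Local Open Scope group_scope.

(* The product carries the library's product topology. *)
Definition is_paratopological (G : groupType) (t : topology G) : Prop :=
  continuous (fun p : topologized t * topologized t =>
    (p.1 : G) * (p.2 : G) : topologized t).

Lemma is_paratopologicalP (G : groupType) (t : topology G) :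
  is_paratopological t <->
  forall (x y : G) (U : set G), opens t U -> U (x * y) ->
    exists V W : set G, [/\ opens t V, opens t W, V x, W y &
      forall v w, V v -> W w -> U (v * w)].
Proof.
split=> [mulC x y U oU Uxy|mulC [x y] A].
  have /(mulC (x, y)) : nbhs (x * y : topologized t) U.
    by exists U; split=> //; exact: subset_refl.
  case=> -[P Q] /= [/topologized_nbhsE[V [oV Vx VP]]].
  move=> /topologized_nbhsE[W [oW Wy WQ]] PQ.
  exists V, W; split=> // v w Vv Ww.
  by apply: (PQ (v, w)); split; [exact: VP|exact: WQ].
move=> /topologized_nbhsE[U [oU Uxy UA]].
have [V [W [oV oW Vx Wy VW]]] := mulC x y U oU Uxy.
apply: (@filterS _ _ _ (V `*` W)) => [[v w] [Vv Ww]|]; first by apply/UA/VW.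
by exists (V, W) => //; split; [exists V|exists W]; split=> //; exact: subset_refl.
Qed.

(* The poset of paratopological group topologies, ordered by inclusion. *)
Record PL (G : groupType) := Paratopology {
  PL_topology :> topology G;
  PL_mul_continuous : `[< is_paratopological PL_topology >] }.

HB.instance Definition _ (G : groupType) := [isSub for @PL_topology G].
HB.instance Definition _ (G : groupType) := [Choice of PL G by <:].
HB.instance Definition _ (G : groupType) :=
  [SubChoice_isSubPOrder of PL G by <: with set_display].

Lemma PL_leE (G : groupType) (s t : PL G) :
  (s <= t)%O <-> opens s `<=` opens t.
Proof. by rewrite leEsub topology_leE. Qed.

Fact is_topology_setT (T : Type) : `[< is_topology (@setT (set T)) >].
Proof. exact/asboolP. Qed.

Definition discrete_top (T : Type) : topology T :=
  Topology (is_topology_setT T).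

Fact is_paratopological_discrete (G : groupType) :
  `[< is_paratopological (discrete_top G) >].
Proof.
apply/asboolP/is_paratopologicalP => x y U _ Uxy.
by exists [set x], [set y]; split=> // v w -> ->.
Qed.

Definition PL_discrete (G : groupType) : PL G :=
  Paratopology (is_paratopological_discrete G).

(* smallest is_topology F is the topology generated by F. *)
Definition transversal_tops (T : Type) (s t : topology T) : Prop :=
  [/\ s <> discrete_top T, t <> discrete_top T &
      smallest (@is_topology T) (opens s `|` opens t) = opens (discrete_top T)].

Definition PL_maximal (G : groupType) : set (PL G) :=
  [set m | m <> PL_discrete G /\
     forall s : PL G, s <> PL_discrete G -> (m <= s)%O -> s = m].

(* infimum d A is the greatest lower bound of A in PL G when A is nonempty (it
   exists by PL_infimumsP below), and d when A is empty. *)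
Definition PM (G : groupType) : PL G :=
  infimum (PL_discrete G) (@PL_maximal G).

(* Infima are taken in PL G: the greatest lower bound of a family is the join
   of its lower bounds, which may be strictly coarser than its intersection. *)
Section Infima.
Context (G : groupType).
Implicit Types (A : set (PL G)).

Lemma is_topology_smallest (T : Type) (F : set (set T)) :
  is_topology (smallest (@is_topology T) F).
Proof.
split=> [O [[]//]|A B FA FB O /[dup] -[[_ OI _] _] OF|E EF O /[dup] -[[_ _ OU] _] OF].
- by apply: OI; [exact: FA|exact: FB].
- by apply: OU => A /EF; apply.
Qed.

Definition PL_join_opens A : set (set G) :=
  smallest (@is_topology G) (\bigcup_(t in A) opens (t : PL G)).

Definition join_top A : topology G :=
  Topology (asboolT (is_topology_smallest (\bigcup_(t in A) opens (t : PL G)))).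

Lemma is_paratopological_join A : is_paratopological (join_top A).
Proof.
apply/is_paratopologicalP.
have [JT JI JU] := is_topology_smallest (\bigcup_(t in A) opens (t : PL G)).
pose cont U := forall x y : G, U (x * y) ->
  exists V W : set G, [/\ PL_join_opens A V, PL_join_opens A W, V x, W y &
    forall v w, V v -> W w -> U (v * w)].
suff JC U : PL_join_opens A U -> cont U.
  by move=> x y U oU Uxy; apply: JC.
move: U; apply: smallest_sub; last first.
  move=> U [t At tU] x y Uxy.
  have /asboolP/is_paratopologicalP/(_ x y U tU Uxy) := PL_mul_continuous t.
  case=> V [W [tV tW Vx Wy VW]]; exists V, W.
  by split=> //; apply: sub_gen_smallest; exists t.
split=> [x y _|U U' cU cU' x y [Uxy U'xy]|F cF x y [U FU Uxy]].
- by exists setT, setT.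
- have [V [W [oV oW Vx Wy VW]]] := cU x y Uxy.
  have [V' [W' [oV' oW' V'x W'y VW']]] := cU' x y U'xy.
  exists (V `&` V'), (W `&` W'); split; [exact: JI|exact: JI|by []|by []|].
  by move=> v w [Vv V'v] [Ww W'w]; split; [exact: VW|exact: VW'].
- have [V [W [oV oW Vx Wy VW]]] := cF U FU x y Uxy.
  by exists V, W; split=> // v w Vv Ww; exists U => //; exact: VW.
Qed.

Definition PL_join A : PL G := Paratopology (asboolT (@is_paratopological_join A)).

Lemma PL_join_le A (b : PL G) : (PL_join A <= b)%O <-> ubound A b.
Proof.
split=> [/PL_leE jb t At|Ab]; apply/PL_leE.
  apply: subset_trans jb => U tU.
  by apply: sub_gen_smallest; exists t.
apply: smallest_sub; first by have /asboolP := opensP b.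
by move=> U [t At tU]; have /PL_leE := Ab _ At; apply.
Qed.

Lemma PL_infimumsP A : infimums A (PL_join (lbound A)).
Proof.
split=> [t At|t At]; first by apply/PL_join_le => s; apply.
by have /(PL_join_le _ _).1 := lexx (PL_join (lbound A)); apply.
Qed.

Lemma PM_infimums : infimums (@PL_maximal G) (PM G).
Proof.
rewrite /PM /infimum; case: eqP => [->|_].
  by split=> [//|t _]; apply/PL_leE.
by case: xgetP => [_ -> //|/(_ _ (PL_infimumsP _))].
Qed.

End Infima.

(* Main.v *)
(** Above every non-discrete paratopological group topology there is a maximal
    one: by homogeneity a topology is discrete as soon as [{1}] is open, and
    [{1}] is open in the join of a nonempty chain only if it is open in a member
    of the chain, so Zorn's lemma applies.  If [sigma] is transversal to [tau]
    and [m] is maximal above [sigma], then [tau <= PM <= m] would make [m]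
    discrete.  Conversely, if [tau] is not below [PM] then some maximal [m] is
    not finer than [tau]; the join of [m] and [tau] is strictly finer than [m],
    hence discrete, so [m] itself is transversal to [tau]. *)

Require Import Defs.
From mathcomp Require Import all_boot all_order.
From mathcomp Require Import boolp classical_sets topology.

Set Implicit Arguments.
Unset Strict Implicit.
Unset Printing Implicit Defensive.

Import Order.TTheory.
Local Open Scope classical_set_scope.
Local Open Scope group_scope.

Lemma PL_eq_discrete (G : groupType) (t : PL G) :
  (forall U, opens t U) -> t = PL_discrete G.
Proof.
move=> tU; do 2![apply: val_inj => /=].
by apply/seteqP; split.
Qed.

Lemma PL_discreteP (G : groupType) (t : PL G) :
  t = PL_discrete G <-> opens t [set 1].
Proof.
split=> [->//|t1]; apply: PL_eq_discrete => U.
have /asboolP[_ _ tF] := opensP t.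
have tx x : opens t [set x].
  (* Continuity at [(x^-1, x)] gives an open [W] around [x] with [x^-1 * w = 1] for all [w] in [W];
     continuity of inversion is never invoked. *)
  have /asboolP/is_paratopologicalP/(_ x^-1 x [set 1] t1) := PL_mul_continuous t.
  case=> [|V [W [_ tW Vx Wx VW]]]; first exact: mulVg.
  suff <- : W = [set x] by [].
  apply/seteqP; split=> [w Ww|_ -> //].
  by apply: (@mulgI _ x^-1); rewrite mulVg; apply: VW.
rewrite -[U]image_id -bigcup_imset1 -(bigcup_image U set1 id).
by apply: tF => _ [x _ <-].
Qed.

(** The sets with this property at each of their points form a topology containing every member of
    [A]: of two members of a chain, the finer one has both neighbourhoods open. *)
Lemma PL_join_chain_nbhs (G : groupType) (A : set (PL G)) (U : set G) (x : G) :
  A !=set0 -> total_on A (fun s t => (s <= t)%O) ->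
  opens (PL_join A) U -> U x ->
  exists t V, [/\ A t, opens (t : PL G) V, V x & V `<=` U].
Proof.
move=> [t0 At0] Atot JU.
pose base U := forall x, U x ->
  exists t V, [/\ A t, opens (t : PL G) V, V x & V `<=` U].
suff bU : base U by exact: bU.
move: U {x} JU; apply: smallest_sub; last first.
  by move=> U [t At tU] x Ux; exists t, U; split=> //; exact: subset_refl.
split=> [x _|U U' bU bU' x [Ux U'x]|F bF x [U FU Ux]].
- by exists t0, setT; split=> //; have /asboolP[] := opensP t0.
- have [s [V [As sV Vx VU]]] := bU x Ux.
  have [t [W [At tW Wx WU']]] := bU' x U'x.
  have VW : V `&` W `<=` U `&` U' by exact: setISS.
  have [st|ts] := Atot _ _ As At.
  + exists t, (V `&` W); split=> //.
    have /asboolP[_ tI _] := opensP t; apply: tI => //.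
    by move/PL_leE: st; apply.
  + exists s, (V `&` W); split=> //.
    have /asboolP[_ sI _] := opensP s; apply: sI => //.
    by move/PL_leE: ts; apply.
- have [t [V [At tV Vx VU]]] := bF U FU x Ux.
  by exists t, V; split=> // y /VU Uy; exists U.
Qed.

Lemma PL_join_chain_nondiscrete (G : groupType) (A : set (PL G)) :
  A !=set0 -> total_on A (fun s t => (s <= t)%O) ->
  (forall t, A t -> t <> PL_discrete G) -> PL_join A <> PL_discrete G.
Proof.
move=> A0 Atot And /PL_discreteP J1.
have [t [V [At tV V1 VS]]] := PL_join_chain_nbhs A0 Atot J1 (erefl 1).
apply: (And t At); apply/PL_discreteP.
suff <- : V = [set 1] by [].
by apply/seteqP; split=> // _ ->.
Qed.

Lemma exists_PL_maximal (G : groupType) (s : PL G) :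
  s <> PL_discrete G -> exists2 m, PL_maximal m & (s <= m)%O.
Proof.
move=> snd.
pose T := {t : PL G | t <> PL_discrete G /\ (s <= t)%O}.
have [||||[m [mnd sm]] mmax] := @Zorn T (fun t u => (sval t <= sval u)%O).
- by move=> t; exact: lexx.
- by move=> t u v; exact: le_trans.
- move=> [t tP] [u uP] /= tu ut; apply: eq_exist.
  by apply/eqP; rewrite eq_le tu ut.
(* Adding [s] keeps the family nonempty when the chain [A] is empty, and puts its join above [s]. *)
- move=> A Atot; pose B : set (PL G) := s |` (sval @` A).
  have /PL_join_le JB := lexx (PL_join B).
  have Jnd : PL_join B <> PL_discrete G.
    apply: PL_join_chain_nondiscrete.
    + by exists s; left.
    + move=> t u [->|[t' At' <-]] [->|[u' Au' <-]].
      * by left.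
      * by left; case: (svalP u').
      * by right; case: (svalP t').
      * exact: Atot.
    + by move=> t [->//|[t' _ <-]]; case: (svalP t').
  have sJ : (s <= PL_join B)%O by apply: JB; left.
  exists (exist _ (PL_join B) (conj Jnd sJ)) => t At /=.
  by apply: JB; right; exists t.
- exists m => //; split=> // t tnd mt.
  by have [] := mmax (exist _ t (conj tnd (le_trans sm mt))) mt.
Qed.

Theorem theorem4p6 (G : groupType) (tau : PL G) (htau : tau <> PL_discrete G) :
  (exists sigma : PL G, transversal_tops sigma tau) <-> ~ (tau <= PM G)%O.
Proof.
have [PMlb PMglb] := PM_infimums G.
split=> [[sigma [snd _ st]] tauPM|tauPM].
  have [|m mM sm] := @exists_PL_maximal _ sigma; first by move=> sE; rewrite sE in snd.
  have [mnd _] := mM; apply/mnd/PL_eq_discrete => U.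
  have : opens (discrete_top G) U by [].
  (* [m] contains the topology generated by [sigma] and [tau] as soon as it is finer than both. *)
  rewrite -st; move: U; apply: smallest_sub; first by have /asboolP := opensP m.
  rewrite subUset; split; apply/PL_leE => //.
  exact: le_trans tauPM (PMlb m mM).
have /existsNP[m /not_implyP[mM taum]] : ~ lbound (@PL_maximal G) tau.
  by move=> /PMglb.
have [mnd mmax] := mM.
have /PL_join_le J := lexx (PL_join [set m; tau]).
have mJ : (m <= PL_join [set m; tau])%O by apply: J; left.
have tauJ : (tau <= PL_join [set m; tau])%O by apply: J; right.
have JE : PL_join [set m; tau] = PL_discrete G.
  apply: contrapT => Jnd; apply: taum.
  by rewrite -(mmax _ Jnd mJ).
exists m; split.
- by move=> mE; apply: mnd; apply: val_inj.
- by move=> tE; apply: htau; apply: val_inj.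
(* A join in [PL G] has as open sets exactly the topology generated by the union, so its
   discreteness is transversality. *)
- have -> : discrete_top G = PL_join [set m; tau] by rewrite JE.
  by rewrite /= /join_top /= bigcup_setU !bigcup_set1.
Qed.
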